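(* Let $T=(1,3^k,1)$ with $k\ge 3$. There are exactly $8$ potential Jordan degree types for pairs $(A,\ell)$ with $A\in\mathrm{Gor}(T)$ and $\ell\in A_1$; equivalently, there are exactly $8$ potential rank matrices for $T$.
   Context: $\mathsf{k}$ is an infinite field of arbitrary characteristic, $R=\mathsf{k}[x,y,z]$ with the standard grading; $3^k$ means $3$ repeated $k$ times. $\mathrm{Gor}(T)$ is the family of graded Artinian Gorenstein (AG) quotients $A=R/I$ with Hilbert function $T=(t_0,\dots,t_j)$; $j$ is the socle degree and $s=\max_i t_i$. For a nonzero linear form $\ell\in A_1$, the rank matrix $M_{A,\ell}$ is the $(j+1)\times(j+1)$ upper triangular matrix (indices $0,\dots,j$) with $(u,v)$ entry, $u\le v$, the rank of $\ell^{v-u}:A_u\to A_v$. A potential rank matrix for $T$ is an upper triangular $(j+1)\times(j+1)$ matrix $M$ of non-negative integers, with rows and columns indexed by $0,\dots,j$, satisfying the known necessary conditions for rank matrices: (i) writing $H(i)=(M_{0,i},M_{1,i+1},\dots,M_{j-i,j})$ for the $i$-th diagonal, $H(0)=T$, $H(1)\ne 0$, and each $H(i)$ is either zero or the Hilbert function of a graded AG quotient of $R$ of socle degree $j-i$; (ii) each difference $H(i)-(0,H(i+1))$ is an O-sequence, i.e. zero or the Hilbert function of a standard graded algebra; (iii) in the upper triangular part, rows are non-increasing from left to right and columns are non-decreasing from top to bottom; (iv) $M_{u+1,v}+M_{u,v+1}\ge M_{u,v}+M_{u+1,v+1}$ whenever $0\le u<v<j$; (v) for all $u\le v$ with $t_u=t_v=s$,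 the entry $M_{u,v}$ depends only on $v-u$. The potential Jordan degree type associated with $M$ is the multiset of pairs $(p,\nu)$ (strings of length $p$ starting in degree $\nu$) in which $(v-u+1,u)$ has multiplicity $M_{u,v}+M_{u-1,v+1}-M_{u-1,v}-M_{u,v+1}$ for $0\le u\le v\le j$ (entries with indices out of range being $0$). This correspondence between potential rank matrices and potential Jordan degree types is one-to-one; for $M=M_{A,\ell}$ it gives the actual Jordan degree type of $(A,\ell)$, i.e. the lengths and initial degrees of the strings in a decomposition of $A$ into graded cyclic $\mathsf{k}[\ell]$-modules. *)

(* Defs.v *)
From mathcomp Require Import all_boot all_order all_algebra.
From mathcomp Require Import finmap multiset.
From mathcomp Require Import mpoly.

Set Implicit Arguments.
Unset Strict Implicit.
Unset Printing Implicit Defensive.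

Import GRing.Theory.
Local Open Scope ring_scope.
Local Open Scope mset_scope.

Section GradedQuotients.
Variables (F : fieldType) (n : nat).
Implicit Type I : {pred {mpoly F[n]}}.

(* A proper homogeneous ideal ([idealr_closed] includes 1 \notin I): the
   quotients by these are the nonzero standard graded F-algebras generated by
   n elements of degree 1 (any n linear forms, possibly dependent). *)
Definition homogeneous_ideal I : Prop :=
  idealr_closed I /\ forall p d, p \in I -> pihomog mdeg d p \in I.

(* dim_F (R/I)_d = h: some h forms of degree d induce a basis of R_d / I_d. *)
Definition quotient_dim I (d h : nat) : Prop :=
  exists b : 'I_h -> {mpoly F[n]},
    (forall i, b i \is d.-homog) /\
    (forall f : {mpoly F[n]}, f \is d.-homog ->
       exists! c : 'rV[F]_h, f - \sum_(i < h) c 0 i *: b i \in I).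

(* Sequences are finite, and stand for their extension by zeros. *)
Definition has_hilbert_function I (H : seq nat) : Prop :=
  forall d, quotient_dim I d (nth 0%N H d).

(* f represents an element of the socle (0 : m) of A = R/I. *)
Definition in_socle I (f : {mpoly F[n]}) : Prop := forall i, 'X_i * f \in I.

(* A = R/I is Gorenstein: dim_F (0 : m) = 1. *)
Definition gorenstein I : Prop :=
  exists2 f, in_socle I f /\ f \notin I &
    forall g, in_socle I g -> exists c : F, g - c *: f \in I.

(* A_j <> 0 and A_d = 0 for d > j; in particular A is Artinian. For A
   Gorenstein, j is then the degree of its one-dimensional socle. *)
Definition top_degree I (j : nat) : Prop :=
  (exists2 f : {mpoly F[n]}, f \is j.-homog & f \notin I) /\
  (forall d (f : {mpoly F[n]}), (j < d)%N -> f \is d.-homog -> f \in I).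

Definition graded_AG I (j : nat) : Prop :=
  [/\ homogeneous_ideal I, top_degree I j & gorenstein I].

End GradedQuotients.

Definition zero_seq (H : seq nat) : bool := all (pred1 0%N) H.

Definition AG_hilbert_function (F : fieldType) (j : nat) (H : seq nat) : Prop :=
  exists I : {pred {mpoly F[3]}}, graded_AG I j /\ has_hilbert_function I H.

Definition O_sequence (F : fieldType) (H : seq nat) : Prop :=
  zero_seq H \/
  exists (n : nat) (I : {pred {mpoly F[n]}}),
    homogeneous_ideal I /\ has_hilbert_function I H.

Section RankMatrices.
Local Open Scope nat_scope.

(* M_{u,v} for arbitrary u, v, equal to 0 when an index is out of range. *)
Definition entry m (M : 'M[nat]_m) (u v : nat) : nat :=
  if (insub u : option 'I_m, insub v : option 'I_m) is (Some a, Some b)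
  then M a b else 0.

(* H(i) = (M_{0,i}, M_{1,i+1}, ..., M_{j-i,j}), where m = j + 1. *)
Definition diagonal m (M : 'M[nat]_m) (i : nat) : seq nat :=
  [seq entry M u (u + i) | u <- iota 0 (m - i)].

(* H(i) - (0, H(i+1)). By [cols_nondecr] below the subtractions are exact:
   they are M_{u,u+i} - M_{u-1,u+i}. *)
Definition diagonal_diff m (M : 'M[nat]_m) (i : nat) : seq nat :=
  [seq nth 0 (diagonal M i) u - nth 0 (0 :: diagonal M i.+1) u
  | u <- iota 0 (m - i)].

Definition seq_max (T : seq nat) : nat := \max_(t <- T) t.

(* Here T = (t_0, ..., t_j), so that j = (size T).-1. *)
Record potential_rank_matrix (F : fieldType) (T : seq nat)
    (M : 'M[nat]_(size T)) : Prop := PotentialRankMatrix {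
  upper_triangular : forall u v, v < u -> entry M u v = 0;
  diag0 : diagonal M 0 = T;
  diag1 : ~~ zero_seq (diagonal M 1);
  diag_AG : forall i, i < size T ->
    zero_seq (diagonal M i) \/
    AG_hilbert_function F ((size T).-1 - i) (diagonal M i);
  diag_diff_O : forall i, i < size T -> O_sequence F (diagonal_diff M i);
  rows_nonincr : forall u v, u <= v -> v.+1 < size T ->
    entry M u v.+1 <= entry M u v;
  cols_nondecr : forall u v, u < v -> v < size T ->
    entry M u v <= entry M u.+1 v;
  exchange : forall u v, u < v -> v.+1 < size T ->
    entry M u v + entry M u.+1 v.+1 <= entry M u.+1 v + entry M u v.+1;
  constant_on_max : forall u v u' v',
    u <= v -> v < size T -> u' <= v' -> v' < size T ->
    nth 0 T u = seq_max T -> nth 0 T v = seq_max T ->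
    nth 0 T u' = seq_max T -> nth 0 T v' = seq_max T ->
    v - u = v' - u' -> entry M u v = entry M u' v'
}.

(* Multiplicity of the string (v - u + 1, u), with M_{-1,v} = 0. For potential
   rank matrices the subtraction is exact, by [exchange] if 0 < u and v < j,
   by [rows_nonincr] if u = 0, and by [cols_nondecr] if v = j. *)
Definition string_mult m (M : 'M[nat]_m) (u v : nat) : nat :=
  let above w := if u is u'.+1 then entry M u' w else 0 in
  (entry M u v + above v.+1) - (above v + entry M u v.+1).

(* The multiset of pairs (length, initial degree). *)
Definition jordan_degree_type m (M : 'M[nat]_m) : {mset nat * nat} :=
  seq_mset (flatten
    [seq nseq (string_mult M u v) (v - u + 1, u)
    | u <- iota 0 m, v <- iota u (m - u)]).

Definition potential_jordan_degree_type (F : fieldType) (T : seq nat)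
    (D : {mset nat * nat}) : Prop :=
  exists2 M : 'M[nat]_(size T),
    potential_rank_matrix F M & D = jordan_degree_type M.

End RankMatrices.

Definition has_card (K : choiceType) (P : K -> Prop) (N : nat) : Prop :=
  exists S : {fset K}, #|` S| = N /\ forall x, x \in S <-> P x.

Definition infinite_field (F : fieldType) : Prop :=
  forall s : seq F, exists x, x \notin s.

(* Main.v *)
From HB Require Import structures.
Require Import Defs.
From mathcomp Require Import all_boot all_order all_algebra.
From mathcomp Require Import finmap multiset.
From mathcomp Require Import mpoly zify.

(** Write j = k + 1.  The entries of a potential rank matrix that are neither
    in its first row nor in its last column depend only on the diagonal, and the
    two end entries of a diagonal are at most 1 because T starts and ends with
    1.  A standard graded algebra that vanishes in some degree vanishes in all
    higher ones ([hilbert_gt0]), so a nonzero diagonal H(i) is (1, r, ..., r, 1)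
    with r > 0.  The matrix is thus encoded by the sequence r_i = max H(i),
    0 <= i <= k + 1 ([potential_admissible]): the entry (u, v) is
    min(1, r_(v-u)) if u = 0 or v = j, and r_(v-u) otherwise.  The exchange
    inequality says that r is convex when it involves only middle entries, and
    along the first row or last column it becomes
    min(1, r_i) + r_i <= r_(i-1) + min(1, r_(i+1)).
    By convexity, r is constant up to r_(k-1) as soon as two consecutive terms
    agree; if the constant is positive then H(k) = (1, 1), and if it is 1 then
    also H(j) = (1).  Starting from r_0 = 3 and r_1 > 0, this leaves exactly
    eight sequences ([admissible_profile]).

    Conversely each of the eight gives a potential rank matrix
    ([admissible_potential]).  The sequence (1, s, ..., s, 1) is the Hilbert
    function of the algebra dual to a Fermat form X_0^N + ... + X_(s-1)^N in
    divided powers ([AG_hilbert_fermat]), over every field.  The nonzero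
    differences H(i) - (0, H(i+1)) start with 1 and do not increase from degree
    1 on; such sequences are Hilbert functions of quotients of the coordinate
    ring of a union of coordinate axes ([O_sequence_axes]).

    Finally the string multiplicities are second differences of the matrix, so
    that the matrix is recovered from its Jordan degree type by summation from
    its upper right corner ([jordan_degree_type_inj]), and there are as many
    types as matrices. *)

Set Implicit Arguments.
Unset Strict Implicit.
Unset Printing Implicit Defensive.

(** * Ideals defined by the coefficients of pure powers *)

Section Axes.
Import GRing.Theory.
Local Open Scope ring_scope.

Variables (F : fieldType) (n : nat).
Implicit Types (f g : {mpoly F[n]}) (a : 'I_n) (d : nat) (I : {pred {mpoly F[n]}}).

(** Restriction of polynomials to the a-th coordinate axis. *)
Definition axis a : {mpoly F[n]} -> {poly F} :=
  mmap (@polyC F) (fun b => if b == a then 'X else 0).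

HB.instance Definition _ a := GRing.RMorphism.copy (axis a) (axis a).

Lemma coef_axis a f d : (axis a f)`_d = f@_(U_(a) *+ d).
Proof.
have powE m : mmap1 (fun b => if b == a then 'X else 0 : {poly F}) m =
    if m == (U_(a) *+ m a)%MM then 'X^(m a) else 0.
  rewrite /mmap1; case: eqP => [mE|mN].
    rewrite (bigD1 a) //= eqxx big1 ?mulr1 // => b neq.
    by rewrite (negPf neq) mE mulmnE mnm1E eq_sym (negPf neq) expr0.
  have [b /andP[neq mb]] : exists b, (b != a) && (m b != 0%N).
    apply/existsP; apply: contra_notT mN => /existsPn mN.
    apply/mnmP => b; rewrite mulmnE mnm1E eq_sym.
    by have [->|neq] := eqVneq b a; [rewrite mul1n | move: (mN b); rewrite neq negbK => /eqP].
  by rewrite (bigD1 b) //= (negPf neq) expr0n (negPf mb) mul0r.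
rewrite /axis /mmap coef_sum.
rewrite [f in RHS]mpolyE raddf_sum; apply: eq_bigr => m _.
rewrite powE /= mcoeffZ mcoeffX coefCM; congr (_ * _).
case: eqP => [mE|mN].
  rewrite coefXn; congr (nat_of_bool _)%:R; apply/eqP/eqP => [->|->] //.
  by rewrite mulmnE mnm1E eqxx mul1n.
rewrite coef0; case: eqP => // mE; case: mN.
by rewrite {2}mE mulmnE mnm1E eqxx mul1n.
Qed.

(** Restriction to an axis is a ring morphism, hence the coefficients of the
    powers of a single variable multiply as in one variable: no mixed monomial
    contributes.  This is what makes the conditions below define ideals. *)
Lemma mcoeff_axisM a f g d :
  (f * g)@_(U_(a) *+ d) =
  \sum_(i < d.+1) f@_(U_(a) *+ i) * g@_(U_(a) *+ (d - i)).
Proof.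
rewrite -coef_axis rmorphM coefM.
by apply: eq_bigr => i _; rewrite !coef_axis.
Qed.

Lemma mdeg_axis a d : mdeg (U_(a) *+ d) = d.
Proof. by rewrite mdegMn mdeg1 mul1n. Qed.

Lemma mcoeff_pihomog d f m :
  (pihomog mdeg d f)@_m = if mdeg m == d then f@_m else 0.
Proof.
case: ifP => [/eqP md|md]; last first.
  by rewrite (dhomog_nemf_coeff (pihomogP _ d f)) // md.
rewrite pihomogE raddf_sum [f in RHS]mpolyE raddf_sum /= big_mkcond.
apply: eq_bigr => m' _; rewrite mcoeffZ mcoeffX.
by case: (m' =P m) => [->|]; rewrite ?md ?eqxx ?mulr0 ?if_same.
Qed.

(** To compute the dimension of a graded piece it suffices to exhibit h linear
    functionals that cut out I in degree d, with a dual family of forms. *)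
Lemma quotient_dim_of_coords I d h (L : {mpoly F[n]} -> 'rV[F]_h)
    (b : 'I_h -> {mpoly F[n]}) :
    linear L -> (forall i, b i \is d.-homog) ->
    (forall i j, L (b i) 0 j = (i == j)%:R) ->
    (forall f, f \is d.-homog -> (f \in I) = (L f == 0)) ->
  quotient_dim I d h.
Proof.
move=> linL bd Lb IL; exists b; split=> // f fd.
pose LM := GRing.isLinear.Build _ _ _ _ L linL.
pose L' : {linear {mpoly F[n]} -> 'rV[F]_h} := HB.pack L LM.
have inI (c : 'rV[F]_h) : (f - \sum_(i < h) c 0 i *: b i \in I) = (L f == c).
  rewrite IL; last first.
    by rewrite rpredB // rpred_sum // => i _; rewrite rpredZ.
  suff -> : L (f - \sum_(i < h) c 0 i *: b i) = L f - c by rewrite subr_eq0.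
  have LB u v : L (u - v) = L u - L v by exact: (raddfB L').
  have LZ x u : L (x *: u) = x *: L u by exact: (linearZ_LR L').
  have Lsum (G : 'I_h -> _) : L (\sum_i G i) = \sum_i L (G i).
    exact: (raddf_sum L').
  rewrite LB Lsum; congr (_ - _).
  apply/rowP => j; rewrite summxE (bigD1 j) //= LZ mxE Lb eqxx mulr1.
  by rewrite big1 ?addr0 // => i ij; rewrite LZ mxE Lb (negPf ij) mulr0.
exists (L f); split=> [|c]; first by rewrite inI.
by rewrite inI => /eqP.
Qed.

Lemma powerX a d : 'X_a ^+ d = 'X_[(U_(a) *+ d)%MM] :> {mpoly F[n]}.
Proof. by rewrite mpolyXn. Qed.

Lemma powerX_homog a d : ('X_a ^+ d : {mpoly F[n]}) \is d.-homog.
Proof. by rewrite powerX dhomogX /= mdeg_axis. Qed.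

Lemma mcoeff_powerX a b d e :
  ('X_b ^+ e : {mpoly F[n]})@_(U_(a) *+ d) =
  ((d == e) && ((0 < d) ==> (a == b))%N)%:R.
Proof.
rewrite powerX mcoeffX; congr (nat_of_bool _)%:R; apply/eqP/andP.
  move=> E; have de : d = e by move: (congr1 mdeg E); rewrite !mdeg_axis.
  split; rewrite ?de //; apply/implyP => e0.
  move/mnmP/(_ a): E; rewrite !mulmnE !mnm1E eqxx de mul1n eq_sym.
  by case: eqP => // _; rewrite mul0n => e1; rewrite -e1 in e0.
case=> /eqP -> /implyP; case: e => [_|e /(_ isT) /eqP -> //].
by rewrite !mulm0n.
Qed.

(** Every monomial of degree j is a multiple of one of degree d; if the quotient
    vanished in degree d, it would also vanish in degree j. *)
Lemma hilbert_gt0 I j H d : homogeneous_ideal I -> top_degree I j ->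
  has_hilbert_function I H -> (d <= j)%N -> (0 < nth 0%N H d)%N.
Proof.
case=> [[I0 _ IM] hom] [[f fj fI] _] hH dj; rewrite lt0n; apply: contra fI => /eqP H0.
have [b [_ Hb]] := hH d; rewrite H0 in b Hb.
have inI g : g \is d.-homog -> g \in I.
  by move=> /Hb [c []]; rewrite big_ord0 subr0.
have sumI (s : seq _) (G : _ -> {mpoly F[n]}) :
    (forall m, m \in s -> G m \in I) -> \sum_(m <- s) G m \in I.
  move=> GI; rewrite big_seq; elim/big_ind: _ => // u v uI vI.
  by rewrite -[u]mul1r IM.
rewrite [f]mpolyE; apply: sumI => m /(dhomog_mf fj) /= mj.
(* move one variable at a time from m1 to m2 until m2 has degree d *)
have [m1 [m2 [-> md]]] : exists m1 m2, m = (m1 + m2)%MM /\ mdeg m2 = d.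
  have {mj} dm : (d <= mdeg m)%N by rewrite mj.
  elim: {f fj inI j dj b Hb H0} d m dm => [|d IH] m dm.
    by exists m, 0%MM; rewrite addm0 mdeg0.
  have [m1 [m2 [mE md]]] := IH m (ltnW dm).
  have : mdeg m1 != 0%N by move: dm; rewrite mE mdegD md; lia.
  rewrite mdeg_eq0 => m1N; have [i m1i] : exists i, m1 i != 0%N.
    apply/existsP; apply: contraR m1N => /existsPn m1N.
    by apply/eqP/mnmP => i; rewrite mnm0E; apply/eqP; move: (m1N i); rewrite negbK.
  exists (m1 - U_(i))%MM, (m2 + U_(i))%MM; split; last by rewrite mdegD mdeg1 md addn1.
  rewrite [(m2 + _)%MM]addmC addmA submK // ?mE //.
  by apply/mnm_lepP => l; rewrite mnm1E; case: eqP => // <-; rewrite lt0n.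
rewrite mpolyXD scalerAl -[_ * _]addr0 IM //; apply: inI.
by rewrite dhomogX /= md.
Qed.

(** For H_0 = 1, the monomial ideal spanned by all mixed monomials and by the
    powers 'X_a^d with d > 0 and a >= H_d: for d > 0 the surviving monomials of degree d are the d-th powers of
    the first H_d variables. *)
Definition axes_ideal (H : seq nat) : {pred {mpoly F[n]}} :=
  [pred f : {mpoly F[n]} | [forall a : 'I_n, forall d : 'I_(size H),
     (a < nth 0 H d)%N ==> (f@_(U_(a) *+ d) == 0)]].

Lemma axes_idealP H f :
  reflect (forall a d, (a < nth 0 H d)%N -> f@_(U_(a) *+ d) = 0)
    (f \in axes_ideal H).
Proof.
apply: (iffP forallP) => [fI a d|fI a]; last first.
  by apply/forallP => d; apply/implyP => /fI ->.
case: (ltnP d (size H)) => [dH|dH]; last by rewrite nth_default.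
by move/forallP: (fI a) => /(_ (Ordinal dH)) /implyP /= => /[apply] /eqP.
Qed.

Lemma axes_ideal_homogeneous H : (0 < n)%N -> nth 0%N H 0 = 1%N ->
    (forall d, (0 < d)%N -> (nth 0 H d.+1 <= nth 0 H d)%N) ->
  homogeneous_ideal (axes_ideal H).
Proof.
move=> n0 H0 Hdec.
have Hle d e : (0 < d <= e)%N -> (nth 0 H e <= nth 0 H d)%N.
  case/andP=> d0; elim: e => [|e IH]; first by case: d d0.
  rewrite leq_eqVlt => /predU1P[-> //|]; rewrite ltnS => de.
  by apply: leq_trans (IH de); apply: Hdec; apply: leq_trans de.
split; last first.
  move=> p d /axes_idealP pI; apply/axes_idealP => a e /pI.
  by rewrite mcoeff_pihomog => ->; rewrite if_same.
split.
- by apply/axes_idealP => a d _; rewrite mcoeff0.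
- apply/axes_idealP => /(_ (Ordinal n0) 0%N).
  by rewrite H0 mulm0n mcoeff1 eqxx => /(_ isT) /eqP; rewrite oner_eq0.
- move=> g u v /axes_idealP uI /axes_idealP vI; apply/axes_idealP => a d ad.
  rewrite mcoeffD vI // addr0 mcoeff_axisM big1 // => i _.
  case: (posnP (d - i)%N) => [->|di].
    (* all axes share the constant term, which is tested on the first one *)
    have -> : u@_(U_(a) *+ 0) = u@_(U_(Ordinal n0) *+ 0) by rewrite !mulm0n.
    by rewrite uI ?mulr0 // H0.
  by rewrite uI ?mulr0 // (leq_trans ad) // Hle // di leq_subr.
Qed.

Lemma axes_ideal_hilbert H : nth 0%N H 0 = 1%N ->
    (forall d, (nth 0 H d <= n)%N) -> has_hilbert_function (axes_ideal H) H.
Proof.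
move=> H0 Hn d; pose ax := widen_ord (Hn d).
apply: (@quotient_dim_of_coords _ _ _
  (fun f => \row_i f@_(U_(ax i) *+ d)) (fun i => 'X_(ax i) ^+ d)).
- by move=> c u v; apply/rowP => i; rewrite !mxE mcoeffD mcoeffZ.
- by move=> i; apply: powerX_homog.
- move=> i j; rewrite mxE mcoeff_powerX eqxx /= -val_eqE /=.
  case: d i j {ax} => [|d] i j; last by rewrite eq_sym.
  have j1 := leq_trans (ltn_ord j) (eq_leq H0).
  have i1 := leq_trans (ltn_ord i) (eq_leq H0).
  by congr (nat_of_bool _)%:R; apply/esym/eqP/val_inj => /=; lia.
move=> f fd; apply/axes_idealP/eqP => [fI|/rowP fI a e].
  by apply/rowP => i; rewrite !mxE fI /=.
have [->|ed] := eqVneq e d; last first.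
  by rewrite (dhomog_nemf_coeff fd) //= mdeg_axis.
move=> ad; move: (fI (Ordinal ad)); rewrite !mxE /=.
by congr (_@_(U_(_) *+ _) = _); apply: val_inj.
Qed.

(** The annihilator, for the contraction action, of the divided power form
    X_0^[N] + ... + X_(s-1)^[N]: contracting the form by f yields the
    coefficient of 'X_a^d as the coefficient of X_a^[N-d], for d < N, and the
    sum of the coefficients of the N-th powers as constant term.  Divided powers
    make this independent of the characteristic. *)
Definition fermat_ideal (s N : nat) : {pred {mpoly F[n]}} :=
  [pred f : {mpoly F[n]} |
     [forall a : 'I_n, forall d : 'I_N, (a < s)%N ==> (f@_(U_(a) *+ d) == 0)]
     && (\sum_(a < n | (a < s)%N) f@_(U_(a) *+ N) == 0)].

Lemma fermat_idealP s N f :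
  reflect ((forall a d, (a < s)%N -> (d < N)%N -> f@_(U_(a) *+ d) = 0) /\
           \sum_(a < n | (a < s)%N) f@_(U_(a) *+ N) = 0)
    (f \in fermat_ideal s N).
Proof.
apply: (iffP andP) => [[/forallP fI /eqP fN]|[fI fN]]; split => //.
- move=> a d ad dN; apply/eqP.
  by move/forallP: (fI a) => /(_ (Ordinal dN)) /implyP ->.
- apply/forallP => a; apply/forallP => d; apply/implyP => ad.
  by rewrite fI.
- by apply/eqP.
Qed.

Section Fermat.
Variables (s N : nat).
(* If N = 0, the last condition of [fermat_ideal] is s times the constant
   coefficient, and s may be zero in F unless s = 1. *)
Hypotheses (s0 : (0 < s)%N) (sn : (s <= n)%N) (sN : N = 0%N -> s = 1%N).

Let a0 : 'I_n := Ordinal (leq_trans s0 sn).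

Let sum_powerX e : \sum_(a < n | (a < s)%N) ('X_a0 ^+ e : {mpoly F[n]})@_(U_(a) *+ N)
  = (N == e)%:R.
Proof.
rewrite (bigD1 a0) //= mcoeff_powerX eqxx implybT andbT big1 ?addr0 //.
move=> a /andP[alt aa0]; rewrite mcoeff_powerX (negPf aa0) implybF.
case: posnP => [/sN s1|]; last by rewrite andbF.
move: aa0 alt; rewrite s1 -val_eqE /=; lia.
Qed.

Let const f a b d : d = 0%N -> f@_(U_(a) *+ d) = f@_(U_(b) *+ d).
Proof. by move=> ->; rewrite !mulm0n. Qed.

Lemma fermat_ideal_homogeneous : homogeneous_ideal (fermat_ideal s N).
Proof.
split; last first.
  move=> p d /fermat_idealP[pI pN]; apply/fermat_idealP; split=> [a e ae eN|].
    by rewrite mcoeff_pihomog pI // if_same.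
  under eq_bigr do rewrite mcoeff_pihomog mdeg_axis.
  by case: (N == d); rewrite ?pN // big1.
split.
- apply/fermat_idealP; split=> [a d _ _|]; first by rewrite mcoeff0.
  by rewrite big1 // => a _; rewrite mcoeff0.
- apply/fermat_idealP => -[fI fN].
  move: (sum_powerX 0); rewrite expr0 fN.
  case: posnP => [_ /esym/eqP|N0 _]; first by rewrite oner_eq0.
  move: (fI a0 0%N s0 N0).
  by rewrite mulm0n mcoeff1 eqxx => /eqP; rewrite oner_eq0.
- move=> g u v /fermat_idealP[uI uN] /fermat_idealP[vI vN].
  apply/fermat_idealP; split=> [a d ad dN|].
    rewrite mcoeffD vI // addr0 mcoeff_axisM big1 // => i _.
    by rewrite uI ?mulr0 // (leq_ltn_trans (leq_subr _ _)).
  under eq_bigr do rewrite mcoeffD.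
  rewrite big_split /= vN addr0 -[RHS](mulr0 g@_(U_(a0) *+ 0)) -[in RHS]uN mulr_sumr.
  apply: eq_bigr => a ad; rewrite mcoeff_axisM big_ord_recl /= subn0.
  rewrite (const g a a0 (erefl 0%N)) big1 ?addr0 // => i _.
  by rewrite uI ?mulr0 // ltn_subrL /bump /= (leq_ltn_trans _ (ltn_ord i)).
Qed.

Lemma fermat_ideal_top : top_degree (fermat_ideal s N) N.
Proof.
split.
  exists ('X_a0 ^+ N); first exact: powerX_homog.
  apply/fermat_idealP => -[_]; rewrite sum_powerX eqxx => /eqP.
  by rewrite oner_eq0.
move=> d f dN fd; apply/fermat_idealP; split=> [a e _ eN|].
  by rewrite (dhomog_nemf_coeff fd) //= mdeg_axis; lia.
by rewrite big1 // => a _; rewrite (dhomog_nemf_coeff fd) //= mdeg_axis; lia.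
Qed.

(** Multiplying g by 'X_a shifts its coefficients on the a-th axis and kills
    those on the other axes, so that a socle element has no coefficient of
    degree less than N on the first s axes; its class is then determined by the
    sum that defines the ideal in degree N. *)
Lemma fermat_ideal_gorenstein : gorenstein (fermat_ideal s N).
Proof.
have [[hom1 homI] [_ topI]] := (fermat_ideal_homogeneous, fermat_ideal_top).
exists ('X_a0 ^+ N); first split.
- move=> i; apply: (topI N.+1) => //; rewrite -addn1 addnC.
  by apply: dhomogM; rewrite ?powerX_homog // -['X_i]expr1 powerX_homog.
- apply/fermat_idealP => -[_]; rewrite sum_powerX eqxx => /eqP.
  by rewrite oner_eq0.
move=> g gS; exists (\sum_(a < n | (a < s)%N) g@_(U_(a) *+ N)).
have XgE i a d : ('X_i * g)@_(U_(a) *+ d.+1) = (a == i)%:R * g@_(U_(a) *+ d).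
  rewrite mcoeff_axisM (bigD1 (lift ord0 ord0)) //= subn1 /=.
  rewrite -['X_i]expr1 mcoeff_powerX eqxx /= big1 ?addr0 // => j j1.
  rewrite mcoeff_powerX; case: eqP => [je|]; last by rewrite mul0r.
  by case/eqP: j1; apply/val_inj.
apply/fermat_idealP; split=> [a d ad dN|].
  rewrite mcoeffB mcoeffZ mcoeff_powerX (ltn_eqF dN) mulr0 subr0.
  have /fermat_idealP[gI gN] := gS a.
  have [dN1|dN1] := ltnP d.+1 N.
    by move: (gI a d.+1 ad dN1); rewrite XgE eqxx mul1r.
  have NE : N = d.+1 by lia.
  move: gN; rewrite NE (bigD1 a) //= XgE eqxx mul1r big1 ?addr0 // => b.
  by case/andP=> _ ba; rewrite XgE (negPf ba) mul0r.
under eq_bigr do rewrite mcoeffB mcoeffZ.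
by rewrite sumrB -mulr_sumr sum_powerX eqxx mulr1 subrr.
Qed.

Lemma fermat_ideal_hilbert H :
    (forall d, nth 0%N H d = if (d == 0)%N || (d == N) then 1%N
                             else if (d < N)%N then s else 0%N) ->
  has_hilbert_function (fermat_ideal s N) H.
Proof.
have homf0 f d e a : f \is d.-homog -> e != d -> f@_(U_(a) *+ e) = 0.
  by move=> fd ed; rewrite (dhomog_nemf_coeff fd) //= mdeg_axis.
move=> HE d; rewrite HE.
have [->|dN] := eqVneq d N; rewrite ?orbT.
  apply: (@quotient_dim_of_coords _ _ _
    (fun f => \row_(i < 1) \sum_(a < n | (a < s)%N) f@_(U_(a) *+ N))
    (fun=> 'X_a0 ^+ N)).
  - move=> c u v; apply/rowP => i; rewrite !mxE mulr_sumr -big_split /=.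
    by apply: eq_bigr => a _; rewrite mcoeffD mcoeffZ.
  - by move=> _; apply: powerX_homog.
  - by move=> i j; rewrite mxE sum_powerX !ord1 !eqxx.
  move=> f fN; apply/fermat_idealP/eqP => [[_ fI]|/rowP/(_ 0)].
    by apply/rowP => i; rewrite !mxE.
  rewrite !mxE => fI; split=> // a e _ eN.
  by rewrite (homf0 _ N) // (ltn_eqF eN).
have [d0|d0] /= := eqVneq d 0%N.
  subst d; apply: (@quotient_dim_of_coords _ _ _
    (fun f => \row_(i < 1) f@_(U_(a0) *+ 0)) (fun=> 'X_a0 ^+ 0)).
  - by move=> c u v; apply/rowP => i; rewrite !mxE mcoeffD mcoeffZ.
  - by move=> _; apply: powerX_homog.
  - by move=> i j; rewrite mxE mcoeff_powerX !ord1 !eqxx.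
  move=> f f0; apply/fermat_idealP/eqP => [[fI _]|/rowP/(_ 0)].
    by apply/rowP => i; rewrite !mxE fI //; lia.
  rewrite !mxE => fI; split=> [a [|e] _ _|]; last first.
  - by rewrite big1 // => a _; rewrite (homf0 _ 0%N) // eq_sym.
  - by rewrite (homf0 _ 0%N).
  - by rewrite (const f a a0).
case: ltnP => [dltN|Nd]; last first.
  apply: (@quotient_dim_of_coords _ _ _ (fun=> 0) (fun=> 0)).
  - by move=> c u v; rewrite scaler0 addr0.
  - by case.
  - by case.
  move=> f fd; rewrite eqxx; have [_ topI] := fermat_ideal_top.
  by apply: (topI d) => //; lia.
pose ax := widen_ord sn.
apply: (@quotient_dim_of_coords _ _ _
  (fun f => \row_i f@_(U_(ax i) *+ d)) (fun i => 'X_(ax i) ^+ d)).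
- by move=> c u v; apply/rowP => i; rewrite !mxE mcoeffD mcoeffZ.
- by move=> i; apply: powerX_homog.
- move=> i j; rewrite mxE mcoeff_powerX eqxx lt0n d0 /= -val_eqE /=.
  by rewrite eq_sym.
move=> f fd; apply/fermat_idealP/eqP => [[fI _]|/rowP fI].
  by apply/rowP => i; rewrite !mxE fI /=.
split=> [a e ad eN|]; last first.
  by rewrite big1 // => a _; rewrite (homf0 _ d) // eq_sym.
have [->|ed] := eqVneq e d; last by rewrite (homf0 _ d).
move: (fI (Ordinal ad)); rewrite !mxE /=.
by congr (_@_(U_(_) *+ _) = _); apply: val_inj.
Qed.

End Fermat.
End Axes.

Lemma O_sequence_axes (F : fieldType) (H : seq nat) : nth 0 H 0 = 1 ->
    (forall d, 0 < d -> nth 0 H d.+1 <= nth 0 H d) -> O_sequence F H.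
Proof.
move=> H0 Hdec.
(* at least one variable, so that the ideal is proper even if H 1 = 0 *)
right; exists (maxn 1 (nth 0 H 1)), (@axes_ideal F _ H); split.
  by apply: axes_ideal_homogeneous => //; lia.
apply: axes_ideal_hilbert => // -[|d]; first by lia.
rewrite leq_max; apply/orP; right; elim: d => // d; apply: leq_trans.
exact: Hdec.
Qed.

Lemma AG_hilbert_fermat (F : fieldType) (s N : nat) (H : seq nat) :
    0 < s <= 3 -> (N = 0 -> s = 1) ->
    (forall d, nth 0 H d = if (d == 0) || (d == N) then 1
                           else if d < N then s else 0) ->
  AG_hilbert_function F N H.
Proof.
move=> /andP[s0 s3] sN HE; exists (@fermat_ideal F 3 s N); split.
  split; [exact: fermat_ideal_homogeneous | exact: fermat_ideal_top |].
  exact: fermat_ideal_gorenstein.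
exact: fermat_ideal_hilbert.
Qed.

(** * Entries, diagonals and Jordan degree types *)

Lemma entry_mx m (f : nat -> nat -> nat) u v :
  entry (\matrix_(a < m, b < m) f a b)%R u v = if (u < m) && (v < m) then f u v else 0.
Proof.
rewrite /entry; case: insubP => [a -> <-|/negPf -> //].
by case: insubP => [b -> <-|/negPf -> //]; rewrite mxE.
Qed.

Lemma entry_out m (M : 'M[nat]_m) u v : ~~ ((u < m) && (v < m)) -> entry M u v = 0.
Proof.
rewrite /entry; case: insubP => [a -> _|//].
by case: insubP => [b -> _|//].
Qed.

Lemma eq_entry m (M M' : 'M[nat]_m) :
  (forall u v, u < m -> v < m -> entry M u v = entry M' u v) -> M = M'.
Proof.
move=> eqM; apply/matrixP => a b.
by have := eqM a b (ltn_ord a) (ltn_ord b); rewrite /entry !valK.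
Qed.

Lemma nth_diagonal m (M : 'M[nat]_m) i d : nth 0 (diagonal M i) d = entry M d (d + i).
Proof.
have [dm|md] := ltnP d (m - i).
  by rewrite (nth_map 0) ?size_iota // nth_iota.
rewrite nth_default ?size_map ?size_iota // entry_out //; lia.
Qed.

Lemma nth_diagonal_diff m (M : 'M[nat]_m) i d :
  nth 0 (diagonal_diff M i) d =
  entry M d (d + i) - (if d is d'.+1 then entry M d' (d + i) else 0).
Proof.
have [dm|md] := ltnP d (m - i).
  rewrite (nth_map 0) ?size_iota // nth_iota // add0n nth_diagonal.
  by case: d dm => //= d _; rewrite nth_diagonal addnS.
by rewrite nth_default ?size_map ?size_iota // entry_out //; lia.
Qed.

Lemma zero_seqP H : reflect (forall d, nth 0 H d = 0) (zero_seq H).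
Proof.
apply: (iffP allP) => [H0 d|H0 x /(nthP 0)[d _ <-]]; last by rewrite /= H0.
have [/(mem_nth 0)/H0/eqP //|dH] := ltnP d (size H).
by rewrite nth_default.
Qed.

(** The truncated subtraction in [string_mult] is exact for potential rank
    matrices: by the exchange inequality inside the matrix, and by monotonicity
    of the rows or columns where the first row or last column is involved. *)
Lemma string_mult_eq (F : fieldType) T (M : 'M[nat]_(size T)) u v :
    potential_rank_matrix F M -> u <= v -> v < size T ->
  string_mult M u v + (if u is u'.+1 then entry M u' v else 0) + entry M u v.+1 =
  entry M u v + (if u is u'.+1 then entry M u' v.+1 else 0).
Proof.
move=> PM uv vT; rewrite /string_mult.
have row := rows_nonincr PM; have col := cols_nondecr PM; have exch := exchange PM.
case: (ltnP v.+1 (size T)) => vT1; case: u uv => [|u] uv.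
- by have := row 0 v uv vT1; lia.
- by have := exch u v uv vT1; lia.
- by rewrite [entry M 0 v.+1]entry_out; lia.
- rewrite [entry M u v.+1]entry_out ?[entry M u.+1 v.+1]entry_out; try lia.
  by have := col u v uv vT; lia.
Qed.

(** By [string_mult_eq] the entry (u, v) is determined by its string
    multiplicity and by its neighbours above and to the right, so that the
    matrix can be rebuilt from the upper right corner. *)
Lemma string_mult_inj (F : fieldType) T (M M' : 'M[nat]_(size T)) :
    potential_rank_matrix F M -> potential_rank_matrix F M' ->
    (forall u v, u <= v -> v < size T -> string_mult M u v = string_mult M' u v) ->
  M = M'.
Proof.
move=> PM PM' eqS; apply: eq_entry => u v _ _.
have [vu|uv] := ltnP v u; first by rewrite (upper_triangular PM) ?(upper_triangular PM').
move: {2}(u + (size T - v)) (leqnn (u + (size T - v))) => w.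
elim: w u v uv => [|w IH] u v uv uw.
  by rewrite !entry_out //; lia.
have [vT|vT] := ltnP v (size T); last by rewrite !entry_out //; lia.
have := string_mult_eq PM uv vT; have := string_mult_eq PM' uv vT.
rewrite (eqS u v) // (IH u v.+1); try lia.
case: u uv uw => [|u] uv uw; first by lia.
by rewrite (IH u v) ?(IH u v.+1); lia.
Qed.

Lemma jordan_degree_type_mult m (M : 'M[nat]_m) u v : u <= v -> v < m ->
  jordan_degree_type M (v - u + 1, u) = string_mult M u v.
Proof.
move=> uv vm; rewrite /jordan_degree_type mset_seqE count_flatten.
rewrite sumnE big_map big_allpairs_dep /=.
rewrite (bigD1_seq u) ?mem_iota ?iota_uniq //=; last by lia.
rewrite (bigD1_seq v) ?mem_iota ?iota_uniq //=; last by lia.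
rewrite count_nseq /= eqxx mul1n !big1_seq ?addn0 // => i.
  move=> /andP[iu _]; rewrite big1_seq // => j _.
  by rewrite count_nseq /= xpair_eqE (negPf iu) andbF.
rewrite mem_iota => /andP[iv ui]; rewrite count_nseq /= xpair_eqE eqxx andbT.
by rewrite (_ : _ == _ = false) //; lia.
Qed.

Lemma jordan_degree_type_inj (F : fieldType) T (M M' : 'M[nat]_(size T)) :
    potential_rank_matrix F M -> potential_rank_matrix F M' ->
  jordan_degree_type M = jordan_degree_type M' -> M = M'.
Proof.
move=> PM PM' eqJ; apply: (string_mult_inj PM PM') => u v uv vT.
by rewrite -!jordan_degree_type_mult // eqJ.
Qed.

(** * Classification of the sequences of diagonal maxima *)

Section Classification.
Variable k : nat.

(** The matrix whose i-th diagonal is (1, r_i, ..., r_i, 1), or 0 if r_i = 0;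
    the two end entries are both min(1, r_i). *)
Definition rank_entry (r : nat -> nat) (u v : nat) : nat :=
  if u <= v then
    if (u == 0) || (v == k.+1) then minn 1 (r (v - u)) else r (v - u)
  else 0.

Definition rank_mx m (r : nat -> nat) : 'M[nat]_m :=
  (\matrix_(u < m, v < m) rank_entry r u v)%R.

(** The conditions on (r_0, ..., r_(k+1)) under which [rank_mx] is a potential
    rank matrix.  The exchange inequality becomes convexity when it involves only
    middle entries, and [adm_corner] when it involves the first row or the last
    column, these two cases being symmetric.  Since H(k) has only its two end entries,
    r_k is at most 1. *)
Record admissible (r : nat -> nat) : Prop := Admissible {
  adm0 : r 0 = 3;
  adm1 : 0 < r 1;
  adm_mono : forall i, i <= k -> r i.+1 <= r i;
  adm_convex : forall i, i.+2 < k -> r i.+1 + r i.+1 <= r i + r i.+2;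
  adm_corner : forall i, i < k ->
    minn 1 (r i.+1) + r i.+1 <= r i + minn 1 (r i.+2);
  adm_last : r k <= 1
}.

Hypothesis k3 : 3 <= k.

(** The possible values of (r_1, r_2, r_(k+1)). *)
Definition codes : seq (nat * nat * nat) :=
  [:: (3, 3, 0); (3, 3, 1); (2, 2, 0); (2, 2, 1);
      (2, 1, 0); (2, 1, 1); (1, 1, 1); (1, 0, 0)].

(** The terms r_3, ..., r_k are determined by r_2 and e = r_(k+1): if r_2 <= 1
    they all equal e, and otherwise the sequence stays at r_2 up to r_(k-1) and
    r_k = 1. *)
Definition profile (c : nat * nat * nat) (i : nat) : nat :=
  let: (r1, r2, e) := c in
  if i == 0 then 3 else if i == 1 then r1 else if i == 2 then r2
  else if r2 <= 1 then e else if i < k then r2 else if i == k then 1 else e.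

Lemma codesP (P : nat * nat * nat -> Prop) :
  P (3, 3, 0) -> P (3, 3, 1) -> P (2, 2, 0) -> P (2, 2, 1) ->
  P (2, 1, 0) -> P (2, 1, 1) -> P (1, 1, 1) -> P (1, 0, 0) ->
  forall c, c \in codes -> P c.
Proof.
move=> P1 P2 P3 P4 P5 P6 P7 P8 c; rewrite !inE.
by do 7! [case/predU1P=> [-> //|]]; move=> /eqP ->.
Qed.

Lemma profile_admissible c : c \in codes -> admissible (profile c).
Proof.
move: c; apply: codesP; split=> //=; rewrite /profile; try (case=> [|[|[|i]]]);
  move=> /=; repeat case: ifP => /= ?; lia.
Qed.

(** Convexity makes the decrements of r decrease, so that r is constant (up to
    r_(k-1)) after two equal consecutive terms.  If the constant is positive, the
    corner condition then forces r_k = 1, and also r_(k+1) = 1 if it is 1.  Otherwise r decreases strictly until it reaches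
    0 or the end, with smaller and smaller decrements, as 3, 2, 1 or 3, 1. *)
Lemma admissible_profile r : admissible r ->
  exists2 c, c \in codes & forall i, i <= k.+1 -> r i = profile c i.
Proof.
case=> r0 r1 mono conv corn last.
have monoW i l : i + l <= k.+1 -> r (i + l) <= r i.
  elim: l => [|l IH] il; first by rewrite addn0.
  rewrite addnS; apply: leq_trans (mono _ _) (IH _); lia.
have flat i : i.+1 < k -> r i.+1 = r i -> forall l, i + l < k -> r (i + l) = r i.
  move=> ik ri; elim/ltn_ind=> -[|[|l]] IH il; rewrite ?addn0 ?addn1 //.
  have /(_ ltac:(lia)) := conv (i + l); rewrite -!addnS (IH l) ?(IH l.+1) //; try lia.
  by have := monoW i l.+2; lia.
have flatk i : i.+1 < k -> r i.+1 = r i -> 0 < r i ->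
    r k = 1 /\ (r i = 1 -> r k.+1 = 1).
  move=> ik ri ri0.
  have rk1 := flat i ik ri (k - i - 1); have rk2 := flat i ik ri (k - i - 2).
  have e1 : i + (k - i - 1) = k - 1 by lia.
  have e2 : i + (k - i - 2) = k - 2 by lia.
  rewrite e1 in rk1; rewrite e2 in rk2.
  have := corn (k - 2); have := corn (k - 1).
  have -> : (k - 2).+2 = k by lia.
  have -> : (k - 2).+1 = k - 1 by lia.
  have -> : (k - 1).+2 = k.+1 by lia.
  have -> : (k - 1).+1 = k by lia.
  have := mono k; lia.
have flatE i : i.+1 < k -> r i.+1 = r i -> forall l, i <= l -> l < k -> r l = r i.
  by move=> ik ri l il lk; rewrite -(subnKC il) (flat i) // subnKC.
have mono0 := mono 0 isT; have mono1 := mono 1 ltac:(lia).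
have mono2 := mono 2 ltac:(lia); have conv0 := conv 0 ltac:(lia).
have rke : r k.+1 <= 1 by have := mono k; lia.
have zero i : i <= k.+1 -> r i = 0 -> forall l, i <= l -> l <= k.+1 -> r l = 0.
  by move=> ik ri l il lk; have := monoW i (l - i); rewrite subnKC //; lia.
have : exists c, [/\ c \in codes, r 1 = c.1.1, r 2 = c.1.2, r k.+1 = c.2 &
  forall i, 2 < i <= k -> r i = if c.1.2 <= 1 then c.2 else if i < k then c.1.2 else 1].
  have [r12|r12] := eqVneq (r 2) (r 1).
    have [rk rk1] := flatk 1 ltac:(lia) r12 r1; have fl := flatE 1 ltac:(lia) r12.
    exists (r 1, r 1, r k.+1); split=> //=.
      rewrite !inE !xpair_eqE; have := flatE 0 ltac:(lia); lia.
    move=> i /andP[i2 ik]; case: ifP => r1le.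
      have r11 : r 1 = 1 by lia.
      move: ik; rewrite leq_eqVlt => /predU1P[->|ik]; first by rewrite rk rk1.
      by rewrite fl ?rk1 ?r11 //; lia.
    by case: ltnP => ik'; [rewrite fl; lia | rewrite -rk; congr r; lia].
  have r2e : (r 1 = 2 /\ r 2 = 1) \/ (r 1 = 1 /\ r 2 = 0) by lia.
  case: r2e => -[r1E r2E]; last first.
    exists (1, 0, 0); split=> //=; first by rewrite (zero 2) //; lia.
    by move=> i ?; rewrite (zero 2) //; lia.
  (* the remaining case 3, 2, 1: the rest is constantly 0 or constantly 1 *)
  have tail i : 2 < i <= k.+1 -> r i = r k.+1.
    have [r3|r3] := eqVneq (r 3) 0.
      by move=> ?; rewrite (zero 3) // 1?(zero 3) //; lia.
    have [k4|k4] := ltnP 3 k.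
      have r32 : r 3 = r 2 by lia.
      have [rk rk1] := flatk 2 ltac:(lia) r32 ltac:(lia).
      move=> /andP[i2 ik]; rewrite rk1 //.
      have [ik1|ik1] := ltnP i k; first by rewrite (flatE 2) //; lia.
      have [->|ik2] := eqVneq i k; first by [].
      by rewrite -rk1 //; congr r; lia.
    (* there is no room for a repetition if k = 3: the corner condition at r_3
       gives 2 r_3 <= 1 + r_4 *)
    have k3E : k = 3 by lia.
    have := corn 2; move: rke; rewrite k3E => ? ? ?; have [->|->] : i = 3 \/ i = 4; lia.
  exists (2, 1, r k.+1); split=> //=; last by move=> i ?; apply: tail; lia.
  by case: (r k.+1) rke => [|[|]].
move=> [[[c1 c2] e] /= [cin r1E r2E rkE rE]]; exists (c1, c2, e) => // i ik.
rewrite /profile; case: eqP => [-> //|?]; case: eqP => [-> //|?].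
case: eqP => [-> //|?].
have [ik1|ik1] := leqP i k.
  by rewrite rE; last lia; do ?case: ifP => ? //; lia.
have -> : i = k.+1 by lia.
by rewrite rkE; do ?case: ifP => ? //; lia.
Qed.

(** * The potential rank matrices for (1, 3, ..., 3, 1) *)

Variables (F : fieldType) (T : seq nat).
Hypothesis hT : T = [:: 1] ++ nseq k 3 ++ [:: 1].

Lemma size_T : size T = k.+2.
Proof. by rewrite hT /= size_cat size_nseq addn1. Qed.

Lemma nth_T u : nth 0 T u =
  if (u == 0) || (u == k.+1) then 1 else if u <= k then 3 else 0.
Proof.
rewrite hT; case: u => [|u] //=; rewrite nth_cat size_nseq nth_nseq eqSS.
case: (ltngtP u k) => [//|ku|->]; last by rewrite subnn.
by rewrite -[u - k]prednK ?subn_gt0 //= nth_nil.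
Qed.

Lemma seq_max_T : seq_max T = 3.
Proof.
rewrite hT /seq_max /= big_cons big_cat big_cons big_nil /= big_nseq.
by case: k k3 => // n _; rewrite iterS; elim: n => //= n; lia.
Qed.

Lemma nth_T_max u : (nth 0 T u == seq_max T) = (0 < u <= k).
Proof.
rewrite nth_T seq_max_T; case: u => //= u; rewrite eqSS.
by case: ltngtP.
Qed.

Lemma entry_rank_mx r u v : entry (rank_mx (size T) r) u v =
  if v <= k.+1 then rank_entry r u v else 0.
Proof.
rewrite entry_mx size_T /rank_entry ltnS [v < _]ltnS.
case: (leqP v k.+1) => vk; rewrite ?andbF // andbT.
by case: (leqP u v) => uv; rewrite ?if_same // (leq_trans uv vk).
Qed.

(** The only conditions that do not reduce directly to those of [admissible] are
    the two on Hilbert functions, which are met by Fermat forms and by unions of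
    axes. *)
Lemma admissible_potential r : admissible r -> potential_rank_matrix F (rank_mx (size T) r).
Proof.
case=> r0 r1 mono conv corn last.
have monoW i l : i <= l -> l <= k.+1 -> r l <= r i.
  move=> il; rewrite -(subnKC il); elim: (l - i) => [|d IH] dk; first by rewrite addn0.
  by rewrite addnS; apply: leq_trans (mono _ _) (IH _); lia.
pose M := rank_mx (size T) r.
have ME u i : entry M u (u + i) =
    if u + i <= k.+1 then
      if (u == 0) || (u + i == k.+1) then minn 1 (r i) else r i
    else 0.
  by rewrite entry_rank_mx /rank_entry leq_addr addKn.
have diag0E i : r i = 0 -> zero_seq (diagonal M i).
  move=> ri; apply/zero_seqP => d; rewrite nth_diagonal ME.
  by rewrite ri minn0 !if_same.
have peak i : i <= k.+1 -> r i != 0 -> forall d, nth 0 (diagonal M i) d =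
    if (d == 0) || (d == k.+1 - i) then 1 else if d < k.+1 - i then r i else 0.
  move=> ik ri d; rewrite nth_diagonal ME.
  have -> : (d == k.+1 - i) = (d + i == k.+1) by lia.
  have -> : (d < k.+1 - i) = (d + i < k.+1) by lia.
  by case: ltngtP => di; case: eqP => d0 //=; lia.
have splitv u v : u <= v -> v = u + (v - u) by move/subnKC.
have sT := size_T; split.
- by move=> u v vu; rewrite entry_rank_mx /rank_entry (ltn_geF vu) if_same.
- apply: (@eq_from_nth _ 0) => [|u _]; first by rewrite size_map size_iota subn0.
  rewrite nth_diagonal ME addn0 nth_T r0.
  by repeat case: ifP => ?; lia.
- by apply/zero_seqP => /(_ 0); rewrite nth_diagonal ME /=; lia.
- move=> i ik; have [ri|ri] := eqVneq (r i) 0; [left; exact: diag0E|right].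
  have -> : (size T).-1 = k.+1 by rewrite sT.
  apply: (@AG_hilbert_fermat _ (r i)); last by apply: peak; lia.
    by have := monoW 0 i; lia.
  by move=> ki; have := monoW k i; lia.
- move=> i ik; have [ri|ri] := eqVneq (r i) 0.
    left; apply/zero_seqP => d; rewrite nth_diagonal_diff -nth_diagonal.
    by rewrite (zero_seqP _ (diag0E i ri)).
  apply: O_sequence_axes => [|[//|d] _]; rewrite !nth_diagonal_diff.
    by rewrite ME add0n /=; case: ifP => ?; lia.
  rewrite [d.+2 + i]addSnnS [in X in _ - X <= _]ME.
  rewrite -[d.+1 + i.+1]addSnnS [d.+1 + i in X in _ <= _ - X]addSnnS !ME !addnS !addSn /=.
  by have := mono i; repeat case: ifP => ?; lia.
- move=> u v uv vk; rewrite (splitv u v uv) -addnS !ME.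
  by have := mono (v - u); repeat case: ifP => ?; lia.
- move=> u v uv vk; rewrite (splitv _ _ uv) addSnnS !ME -[u + _.+1]addSnnS ME.
  by have := mono (v - u.+1); repeat case: ifP => ?; lia.
- move=> u v uv vk; rewrite (splitv _ _ uv); move: (v - u.+1) => d.
  rewrite -addnS !ME !addSnnS !ME.
  by have := mono d; have := conv d; have := corn d; repeat case: ifP => ?; lia.
- move=> u v u' v' uv _ uv' _ /eqP + /eqP + /eqP + /eqP +; rewrite !nth_T_max.
  move=> uk vk uk' vk' dE; rewrite (splitv _ _ uv) (splitv _ _ uv') !ME -dE.
  by repeat case: ifP => ?; lia.
Qed.

(** Constancy along the diagonals gives the middle entries, and monotonicity of
    rows and columns bounds the end entries by the two ends of T.  A nonzero H(i) has
    no zero entry by [hilbert_gt0], so that its ends are 1 and its middle entry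
    is positive. *)
Lemma potential_admissible (M : 'M[nat]_(size T)) : potential_rank_matrix F M ->
  exists2 r, admissible r & M = rank_mx (size T) r.
Proof.
move=> PM; have row := rows_nonincr PM; have col := cols_nondecr PM.
have exch := exchange PM; have const := constant_on_max PM; have sT := size_T.
(* The middle of H(i) is empty for i >= k, where its maximum is at its start. *)
pose r i := if i < k then entry M 1 i.+1 else entry M 0 i.
have diag u : entry M u u = nth 0 T u.
  by rewrite -[in RHS](diag0 PM) nth_diagonal addn0.
have row0 v : v <= k.+1 -> entry M 0 v <= 1.
  elim: v => [|v IH] vk; first by rewrite diag nth_T.
  by apply: leq_trans (row 0 v _ _) (IH _) => //; lia.
have colk i : i <= k.+1 -> entry M (k.+1 - i) k.+1 <= 1.
  elim: i => [|i IH] ik; first by rewrite subn0 diag nth_T eqxx.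
  apply: leq_trans (col _ _ _ _) _; try lia.
  by rewrite subnSK // IH // ltnW.
have inner u v : 0 < u -> u <= v -> v <= k -> entry M u v = r (v - u).
  move=> u0 uv vk; rewrite /r ifT; last by lia.
  by apply: const; rewrite ?sT; try apply/eqP; rewrite ?nth_T_max; lia.
have corner i : i <= k.+1 ->
    entry M 0 i = minn 1 (r i) /\ entry M (k.+1 - i) k.+1 = minn 1 (r i).
  move=> ik; have iT : i < size T by rewrite sT.
  have := row0 i ik; have := colk i ik; rewrite /r.
  have [/zero_seqP H0|[I [[homI topI _] HI]]] := diag_AG PM iT.
    have H d : entry M d (d + i) = 0 by rewrite -nth_diagonal.
    have := H 0; have := H 1; have := H (k.+1 - i); rewrite subnK // add0n add1n.
    by move=> -> -> ->; rewrite if_same.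
  have Hpos d : d <= k.+1 - i -> 0 < entry M d (d + i).
    by move=> dk; rewrite -nth_diagonal; apply: (hilbert_gt0 homI topI HI); rewrite sT.
  have := Hpos 0; have := Hpos 1; have := Hpos (k.+1 - i).
  by rewrite subnK // add0n add1n; case: ifP; lia.
have rk : r k = entry M 0 k by rewrite /r ltnn.
exists r; last first.
  apply: eq_entry => u v uT vT; rewrite entry_rank_mx -ltnS -sT vT /rank_entry.
  case: leqP => uv; last by rewrite (upper_triangular PM).
  case: eqP => [->|u0] /=; first by rewrite subn0 (corner v _).1 //; lia.
  case: eqP => [->|vk]; last by apply: inner; lia.
  by rewrite -[in LHS](subKn (_ : u <= k.+1)) ?(corner _ _).2 //; lia.
split.
- by rewrite /r diag nth_T; repeat case: ifP => ?; lia.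
- have T1 : 1 < size T by rewrite sT.
  have [z|[I [[homI topI _] HI]]] := diag_AG PM T1; first by case/negP: (diag1 PM).
  have := hilbert_gt0 homI topI HI (leq0n _).
  by rewrite nth_diagonal (corner 1 isT).1; lia.
- move=> i ik; have [ik1|ik1] := ltnP i.+1 k.
    by rewrite /r ik1 (ltnW ik1); apply: row; lia.
  have [iE|iE] := eqVneq i k.
    by rewrite iE rk /r ifF; [apply: row; lia | lia].
  have kE : k = i.+1 by lia.
  by rewrite -kE rk /r kE ltnSn; apply: col; lia.
- move=> i ik; have := exch 1 i.+2 isT _.
  by rewrite !inner ?subSS ?subn0; lia.
- move=> i ik; have := exch 0 i.+1 isT _.
  have -> : entry M 1 i.+2 = r i.+1.
    have [ik1|ik1] := ltnP i.+1 k; first by rewrite inner // subSS subn0.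
    have kE : k = i.+1 by lia.
    rewrite -kE; have := (corner k (leqnSn _)).2; rewrite subSnn => ->.
    by rewrite rk; have := row0 k (leqnSn _); lia.
  by rewrite (inner 1 i.+1) // subSS subn0 !(corner _ _).1; lia.
- by rewrite rk; apply: row0.
Qed.

Lemma eq_rank_mx r r' : (forall i, i <= k.+1 -> r i = r' i) ->
  rank_mx (size T) r = rank_mx (size T) r'.
Proof.
move=> rr'; apply: eq_entry => u v _ _; rewrite !entry_rank_mx /rank_entry.
by case: ifP => // vk; rewrite rr' // (leq_trans (leq_subr _ _)).
Qed.

(** The code (r_1, r_2, r_(k+1)) can be read off the entries (1, 2), (1, 3) and
    (0, k + 1) of the matrix, since r_(k+1) <= 1. *)
Lemma profile_inj c c' : c \in codes -> c' \in codes ->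
  rank_mx (size T) (profile c) = rank_mx (size T) (profile c') -> c = c'.
Proof.
move=> cin cin' eqM.
have E u v : v <= k.+1 -> rank_entry (profile c) u v = rank_entry (profile c') u v.
  by move=> vk; have := congr1 (fun M => entry M u v) eqM; rewrite !entry_rank_mx vk.
have E1 := E 1 2 ltac:(lia); have E2 := E 1 3 ltac:(lia).
have E3 := E 0 k.+1 (leqnn _); move: E1 E2 E3; rewrite /rank_entry.
move: c cin {E eqM}; apply: codesP; move: c' cin'; apply: codesP => //.
all: rewrite /= /profile ?subn0; repeat case: ifP => /= ?; try lia.
Qed.

Lemma card_potential_rank_matrices : has_card (@potential_rank_matrix F T) 8.
Proof.
exists [fset rank_mx (size T) (profile c) | c in codes]%fset; split.
  rewrite card_in_imfset /=; last exact: profile_inj.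
  by [].
move=> M; split.
  by case/imfsetP => c /= cin ->; apply/admissible_potential/profile_admissible.
case/potential_admissible => r /admissible_profile[c cin rc] ->.
by apply/imfsetP; exists c => //; apply: eq_rank_mx.
Qed.
End Classification.

Lemma has_card_image (K K' : choiceType) (P : K -> Prop) (f : K -> K') N :
    (forall x y, P x -> P y -> f x = f y -> x = y) -> has_card P N ->
  has_card (fun z => exists2 x, P x & z = f x) N.
Proof.
move=> finj [S [SN SP]]; exists (f @` S)%fset; split.
  by rewrite card_in_imfset // => x y /SP Px /SP Py; apply: finj.
move=> z; split; first by case/imfsetP => x /SP Px ->; exists x.
by case=> x /SP Px ->; apply/imfsetP; exists x.
Qed.

Theorem theorem3p3 (F : fieldType) (hF : infinite_field F) (k : nat)
    (hk : 3 <= k) (T : seq nat)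
    (hT : T = [:: 1] ++ nseq k 3 ++ [:: 1]) :
  has_card (fun D : {mset nat * nat}%mset =>
              potential_jordan_degree_type F T D) 8 /\
  has_card (fun M : 'M[nat]_(size T) => potential_rank_matrix F M) 8.
Proof.
have card8 := card_potential_rank_matrices hk F hT.
split=> //; apply: has_card_image card8; exact: jordan_degree_type_inj.
Qed.
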